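(* Let $(X,d)$ be a metric space and $A\subset X$ be a closed set. Then each locally Lipschitz function $\varphi:A\to\mathbb{R}$ can be extended to a locally Lipschitz function $\Phi:X\to\mathbb{R}$, i.e. there is a locally Lipschitz function $\Phi:X\to\mathbb{R}$ with $\Phi(a)=\varphi(a)$ for every $a\in A$.
   Context: A map $f:(X,d)\to(Y,\rho)$ between metric spaces is Lipschitz if there exists $K\ge 0$ such that $\rho(f(p),f(q))\le K\,d(p,q)$ for all $p,q\in X$. A map $f:X\to Y$ is locally Lipschitz if each point $p\in X$ is contained in an open set $U\subset X$ such that the restriction of $f$ to $U$ is Lipschitz. The set $A\subset X$ carries the restricted metric, and $\mathbb{R}$ carries the usual metric. *)

(* Defs.v *)
From HB Require Import structures.
From mathcomp Require Import all_boot all_order all_algebra.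
From mathcomp Require Import all_classical all_reals all_analysis.

Set Implicit Arguments.
Unset Strict Implicit.
Unset Printing Implicit Defensive.

Import Order.TTheory GRing.Theory Num.Theory.
Import numFieldNormedType.Exports.

Local Open Scope classical_set_scope.
Local Open Scope ring_scope.

(* The metric restricted to a subset. The library already equips the type of
   elements of [A] with the induced topology and pseudometric; only the distance
   is added, so that [open] on this type means relatively open in [A]. *)
Section restricted_metric.
Context {R : realType} {X : metricType R} (A : set X).

Let dist (x y : A) : R := mdist (set_val x) (set_val y).

Let dist_ge0 (x y : A) : 0 <= dist x y.
Proof. exact: mdist_ge0. Qed.

Let dist_positivity (x y : A) : dist x y = 0 -> x = y.
Proof. by move=> /mdist_positivity; exact: val_inj. Qed.

Let ballEdist (x : A) (d : R) : ball x d = [set y | dist x y < d].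
Proof.
by rewrite -[LHS]/(set_val @^-1` ball (set_val x) d) ballEmdist.
Qed.

HB.instance Definition _ := @PseudoMetric_isMetric.Build R (A : Type)
  dist dist_ge0 dist_positivity ballEdist.

End restricted_metric.

Lemma mdist_set_typeE {R : realType} {X : metricType R} (A : set X) (x y : A) :
  mdist x y = mdist (set_val x) (set_val y).
Proof. by []. Qed.

(* The library's [lipschitz] is only available between normed modules. *)
Definition mlipschitz {R : realType} {X Y : metricType R} (f : X -> Y) : Prop :=
  exists2 K : R, 0 <= K & forall p q : X, mdist (f p) (f q) <= K * mdist p q.

Definition locally_mlipschitz {R : realType} {X Y : metricType R}
    (f : X -> Y) : Prop :=
  forall p : X, exists U : set X, [/\ open U, U p & mlipschitz (sigL U f)].

(* Main.v *)
(* Since A is closed, every x in X has a scale rho(x) in (0, 1], 1-Lipschitz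
   in x, such that phi is bounded by 1/rho(x) and 1/rho(x)-Lipschitz on A within
   distance rho(x) of x; this includes the x outside A, where the condition is
   void at small scales. The extension is the McShane-type formula
     Phi(x) = inf_a [max(phi(a), -1/rho(x)) + 2 min(d(x,a), 1) / rho(x)^2].
   For x in A, the penalty dominates the variation of phi at the points a within
   rho(x) of x, and is at least 2/rho(x) at the others, so that the infimum is
   attained at a = x. *)
Require Import Defs.
From mathcomp Require Import all_boot all_order all_algebra.
From mathcomp Require Import all_classical all_reals all_analysis.
From mathcomp Require Import ring lra.
Import Order.TTheory GRing.Theory Num.Def Num.Theory.

Local Open Scope classical_set_scope.
Local Open Scope ring_scope.

Section extension.
Set Implicit Arguments.
Unset Strict Implicit.
Context {R : realType} {X : metricType R} {A : set X}.
Implicit Types (phi : A -> R^o) (x y : X) (r s : R).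

(** * Scales controlling [phi] near a point *)

Definition good_radius phi x r : Prop := forall a b : A,
  mdist x (set_val a) < r -> mdist x (set_val b) < r ->
  r * `|phi a| <= 1 /\ r * `|phi a - phi b| <= mdist (set_val a) (set_val b).

Lemma good_radius_shrink phi x y r s : mdist x y + s <= r ->
  good_radius phi x r -> good_radius phi y s.
Proof.
move=> sr gr a b ya yb.
have xy0 := mdist_ge0 x y.
have xa := metric_triangle x y (set_val a).
have xb := metric_triangle x y (set_val b).
have [] := gr a b; [lra | lra | move=> h1 h2].
split.
  by apply: le_trans h1; rewrite ler_wpM2r//; lra.
by apply: le_trans h2; rewrite ler_wpM2r//; lra.
Qed.

Definition good_radii phi x : set R :=
  [set r | 0 <= r <= 1 /\ good_radius phi x r].

(** Off [A], a ball missing [A] makes the condition void. At a point of [A], both [phi] and its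
    slope are bounded nearby, and a small radius has an inverse above both bounds. *)
Lemma good_radii_gt0 phi x : closed A -> locally_mlipschitz phi ->
  exists2 r, 0 < r & good_radii phi x r.
Proof.
move=> cA lphi; have [Ax|nAx] := pselect (A x); last first.
  have : nbhs x (~` A).
    by apply: open_nbhs_nbhs; split => //; exact: closed_openC.
  move=> /nbhs_ballP[e /= e0]; rewrite ballEmdist => eA.
  exists (minr e 1); first by rewrite lt_min e0 ltr01.
  split=> [|a b]; first by rewrite le_min (ltW e0) ler01 ge_min lexx orbT.
  rewrite lt_min => /andP[ae _].
  by have := eA _ ae; case; exact: set_valP.
pose p : A := SigSub (mem_set Ax).
have px : set_val p = x by [].
have [U [oU Up [K K0 lipK]]] := lphi p.
have : nbhs p U by exact: open_nbhs_nbhs.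
move=> /nbhs_ballP[e /= e0]; rewrite ballEmdist => eU.
have {}lipK (a b : A) : mdist x (set_val a) < e -> mdist x (set_val b) < e ->
    `|phi a - phi b| <= K * mdist (set_val a) (set_val b).
  move=> /eU Ua /eU Ub.
  have := lipK (SigSub (mem_set Ua)) (SigSub (mem_set Ub)).
  by rewrite -normrN opprB.
(* [M] dominates the slope [K] and the bound [|phi p| + K] of [|phi a|] for [a] within distance
   [r <= 1] of [p]; the summand 1 forces [r <= 1]. *)
set M := 1 + K + `|phi p|.
have M1 : 1 <= M by rewrite /M -addrA lerDl addr_ge0.
have M0 : 0 < M by lra.
set r := minr e M^-1.
have r0 : 0 < r by rewrite lt_min e0 invr_gt0.
have re : r <= e by rewrite ge_min lexx.
have rM : r * M <= 1 by rewrite -ler_pdivlMr// mul1r ge_min lexx orbT.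
have r1 : r <= 1 by nra.
exists r => //; split=> [|a b xa xb]; first by rewrite (ltW r0).
have xp : mdist x (set_val p) < e by rewrite px mdistxx.
have ap := lipK a p (lt_le_trans xa re) xp.
have ab := lipK a b (lt_le_trans xa re) (lt_le_trans xb re).
have pa : mdist (set_val a) (set_val p) <= 1.
  by rewrite metric_sym px; apply: ltW; apply: lt_le_trans xa _.
have na := ler_normD (phi a - phi p) (phi p); rewrite subrK in na.
have ab0 := mdist_ge0 (set_val a) (set_val b).
have np := normr_ge0 (phi p).
split.
  apply: le_trans rM; rewrite ler_wpM2l ?(ltW r0)// /M.
  have : K * mdist (set_val a) (set_val p) <= K by rewrite ler_piMr.
  lra.
apply: (@le_trans _ _ (r * (K * mdist (set_val a) (set_val b)))).
  by rewrite ler_wpM2l ?(ltW r0).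
have rK : r * K <= 1.
  by apply: le_trans rM; rewrite ler_wpM2l ?(ltW r0)// /M; lra.
by rewrite mulrA ler_piMl.
Qed.

(* Halving the supremum makes the radius itself good. *)
Definition regularity_radius phi x : R := sup (good_radii phi x) / 2.

(** * A positive Lipschitz choice of scale *)

Section regularity_radius_theory.
Variables (phi : A -> R^o).
Hypotheses (cA : closed A) (lphi : locally_mlipschitz phi).
Local Notation rho := (regularity_radius phi).

Let ub_good_radii x : has_ubound (good_radii phi x).
Proof. by exists 1 => r [/andP[]]. Qed.

Lemma regularity_radius_gt0 x : 0 < rho x.
Proof.
have [r r0 gr] := good_radii_gt0 x cA lphi.
by rewrite divr_gt0//; apply: lt_le_trans r0 _; exact: ub_le_sup.
Qed.

Lemma regularity_radius_le1 x : rho x <= 1.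
Proof.
have [r r0 gr] := good_radii_gt0 x cA lphi.
have : sup (good_radii phi x) <= 1.
  by apply: ge_sup => [|s [/andP[]]//]; exists r.
rewrite /regularity_radius; lra.
Qed.

(** The supremum is positive, so some good radius exceeds its half and can be shrunk to it. *)
Lemma good_regularity_radius x : good_radius phi x (rho x).
Proof.
have r0 := regularity_radius_gt0 x.
have [r' s0 gr] := good_radii_gt0 x cA lphi.
have [||s [_ gs] rs] := @sup_gt _ (good_radii phi x) (rho x).
- by exists r'.
- by move: r0; rewrite /regularity_radius; lra.
by apply: good_radius_shrink gs; rewrite mdistxx add0r ltW.
Qed.

Lemma regularity_radius_lip x y : rho x <= rho y + mdist x y.
Proof.
have d0 := mdist_ge0 x y.
have sy0 := regularity_radius_gt0 y.
have [r r0 gr] := good_radii_gt0 x cA lphi.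
suff : sup (good_radii phi x) <= sup (good_radii phi y) + mdist x y.
  by rewrite /regularity_radius; lra.
apply: ge_sup; first by exists r.
move=> s [/andP[s0 s1] gs].
(* Members of [good_radii] are nonnegative, so [s - mdist x y] is a candidate at [y] only if it is;
   otherwise positivity of the supremum at [y] suffices. *)
have [sd|ds] := leP s (mdist x y).
  by move: sy0; rewrite /regularity_radius; lra.
rewrite -lerBlDr; apply: ub_le_sup => //; split; first by apply/andP; lra.
by apply: good_radius_shrink gs; lra.
Qed.

End regularity_radius_theory.

(** * The extension formula *)

Section penalized_infimum.
Variables (phi : A -> R^o) (rho : X -> R) (a0 : A).
Hypotheses (rho_gt0 : forall x, 0 < rho x) (rho_le1 : forall x, rho x <= 1).
Hypothesis rho_lip : forall x y, rho x <= rho y + mdist x y.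
Hypothesis rho_good : forall x, good_radius phi x (rho x).

(* Clipping [phi a] and the distance makes these functions of [x] uniformly
   Lipschitz in [a], which an infimum over [a] preserves. *)
Definition penalized x (a : A) : R :=
  maxr (phi a) (- (rho x)^-1) + 2 * minr (mdist x (set_val a)) 1 * (rho x)^-2.

Definition penalized_inf x : R := inf (range (penalized x)).

(** The clip gives a lower bound uniform in [a], so the infimum is finite even if [phi] is unbounded
    below. *)
Lemma penalized_ge x a : - (rho x)^-1 <= penalized x a.
Proof.
rewrite -[leLHS]addr0 lerD ?le_max ?lexx ?orbT//.
by rewrite !mulr_ge0// ?le_min ?mdist_ge0 ?ler01// invr_ge0 exprn_ge0// ltW.
Qed.

Lemma penalized_inf_le x a : penalized_inf x <= penalized x a.
Proof.
apply: ge_inf; last by exists a.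
by exists (- (rho x)^-1) => _ [b _ <-]; exact: penalized_ge.
Qed.

(** The point [a0] keeps the range nonempty. *)
Lemma penalized_inf_ge x c : (forall a, c <= penalized x a) ->
  c <= penalized_inf x.
Proof.
by move=> h; apply: lb_le_inf; [exists (penalized x a0), a0|move=> _ [a _ <-]].
Qed.

Lemma penalized_inf_extends b : penalized_inf (set_val b) = phi b.
Proof.
set x := set_val b; set r := rho x.
have r0 : 0 < r := rho_gt0 x.
have r1 : r <= 1 := rho_le1 x.
have w0 : 0 < r^-1 by rewrite invr_gt0.
have rw : r * r^-1 = 1 by rewrite divff// gt_eqF.
have w1 : 1 <= r^-1 by rewrite invf_ge1.
have xb : mdist x (set_val b) < r by rewrite mdistxx.
have phib : `|phi b| <= r^-1.
  by have [+ _] := rho_good xb xb; rewrite -ler_pdivlMl// mulr1.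
move: (phib); rewrite ler_norml => /andP[phib1 phib2].
apply/eqP; rewrite eq_le; apply/andP; split.
  apply: le_trans (penalized_inf_le x b) _.
  rewrite /penalized mdistxx (min_idPl _) ?ler01// mulr0 mul0r addr0.
  by rewrite ge_max lexx.
apply: penalized_inf_ge => a; rewrite /penalized -/r -exprVn.
have d0 := mdist_ge0 x (set_val a).
have [ar|ra] := ltP (mdist x (set_val a)) r.
  have [_] := rho_good ar xb; rewrite -/r [mdist _ (set_val b)]metric_sym -/x => h.
  have : `|phi a - phi b| <= r^-1 * mdist x (set_val a) by rewrite ler_pdivlMl.
  rewrite ler_norml => /andP[h1 _].
  (* Near points: the truncation at 1 is inactive, and the slope [1/r] is below [2/r^2] since
     [r <= 1]. *)
  rewrite (min_idPl _); last by lra.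
  apply: (@le_trans _ _ (phi a + 2 * mdist x (set_val a) * r^-1 ^+ 2)).
    rewrite -lerBlDl.
    apply: (@le_trans _ _ (r^-1 * mdist x (set_val a))); first by lra.
    rewrite mulrAC ler_wpM2r//.
    have : r^-1 <= r^-1 ^+ 2 by rewrite expr2 ler_pMl.
    lra.
  by rewrite lerD2r le_max lexx.
(* Far points: the penalty lifts the clip [-1/r] to at least [1/r], which bounds [phi b]. *)
apply: (@le_trans _ _ (- r^-1 + 2 * r * r^-1 ^+ 2)).
  have -> : 2 * r * r^-1 ^+ 2 = 2 * r^-1.
    by rewrite expr2 mulrA -(mulrA 2) rw mulr1.
  lra.
rewrite lerD ?le_max ?lexx ?orbT//.
by rewrite ler_wpM2r ?sqr_ge0// ler_wpM2l// le_min ra.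
Qed.

(** On the ball of radius [e] about [x0], [rho >= e], so [1/rho] is bounded by [W] and
    [W^2]-Lipschitz. All functions [penalized _ a] then share the constant [L], which passes to
    their infimum. *)
Lemma penalized_inf_locally_lip : locally_mlipschitz (penalized_inf : X -> R^o).
Proof.
move=> x0; set e := rho x0 / 2.
have e0 : 0 < e by rewrite divr_gt0.
exists (ball x0 e)°; split; first exact: open_interior.
  exact: nbhsx_ballx.
set W := e^-1.
have W0 : 0 < W by rewrite invr_gt0.
(* The terms account for the clip, the truncated distance and the factor [1/rho^2], in this
   order. *)
set L := W ^+ 2 + 2 * (W ^+ 2 + 2 * W ^+ 3).
have L0 : 0 <= L.
  by rewrite /L !addr_ge0 ?mulr_ge0 ?addr_ge0 ?mulr_ge0 ?exprn_ge0 ?ltW.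
have rhoe x : ball x0 e x -> e <= rho x.
  rewrite ballEmdist /= => xe; have := rho_lip x0 x; rewrite /e in xe *; lra.
have wW x : ball x0 e x -> (rho x)^-1 <= W.
  by move=> /rhoe h; rewrite lef_pV2 ?posrE.
have wlip x y : ball x0 e x -> ball x0 e y ->
    (rho x)^-1 <= (rho y)^-1 + W ^+ 2 * mdist x y.
  move=> /wW hx /wW hy.
  have rx := rho_gt0 x; have ry := rho_gt0 y.
  have -> : (rho x)^-1 =
      (rho y)^-1 + (rho y - rho x) * ((rho x)^-1 * (rho y)^-1).
    by field; rewrite !gt_eqF.
  rewrite lerD2l mulrC.
  have d0 := mdist_ge0 x y.
  have h : rho y - rho x <= mdist x y.
    by have := rho_lip y x; rewrite metric_sym; lra.
  have w0 : 0 <= (rho x)^-1 * (rho y)^-1 by rewrite mulr_ge0// invr_ge0 ltW.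
  apply: le_trans (ler_wpM2l w0 h) _; rewrite ler_wpM2r//.
  by rewrite expr2 ler_pM// invr_ge0 ltW.
have plip x y a : ball x0 e x -> ball x0 e y ->
    penalized x a <= penalized y a + L * mdist x y.
  move=> x_ball y_ball; rewrite /penalized -!exprVn.
  have := wlip _ _ y_ball x_ball; have := wlip _ _ x_ball y_ball; rewrite [mdist y x]metric_sym.
  have := wW _ x_ball; have := wW _ y_ball.
  have : 0 < (rho x)^-1 by rewrite invr_gt0.
  have : 0 < (rho y)^-1 by rewrite invr_gt0.
  have : minr (mdist x (set_val a)) 1 <= minr (mdist y (set_val a)) 1 + mdist x y.
    have tri := metric_triangle x y (set_val a); have d0 := mdist_ge0 x y.
    by rewrite -lerBlDr le_min !lerBlDr !ge_min (addrC (mdist y _)) tri lerDl d0 orbT.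
  have : 0 <= minr (mdist y (set_val a)) 1 by rewrite le_min mdist_ge0 ler01.
  have : minr (mdist y (set_val a)) 1 <= 1 by rewrite ge_min lexx orbT.
  have := mdist_ge0 x y; move: (rho x)^-1 (rho y)^-1 (mdist x y) => u v d.
  move: (minr _ _) (minr _ _) => m n d0 n1 n0 mn v0 u0 vW uW uv vu.
  have hmax : maxr (phi a) (- u) <= maxr (phi a) (- v) + W ^+ 2 * d.
    have Wd : 0 <= W ^+ 2 * d by rewrite mulr_ge0// sqr_ge0.
    rewrite ge_max; apply/andP; split.
      by rewrite -[leLHS]addr0 lerD// le_max lexx.
    by rewrite -lerBlDr le_max; apply/orP; right; lra.
  (* The penalty difference is split as [m u^2 - n v^2 = (m - n) u^2 + n (u - v)(u + v)]. *)
  have h1 : (m - n) * u ^+ 2 <= d * W ^+ 2.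
    apply: (@le_trans _ _ (d * u ^+ 2)); first by rewrite ler_wpM2r ?sqr_ge0//; lra.
    by rewrite ler_wpM2l// lerXn2r// nnegrE ltW.
  have h2 : n * ((u - v) * (u + v)) <= W ^+ 2 * d * (2 * W).
    have Wd : 0 <= W ^+ 2 * d by rewrite mulr_ge0// sqr_ge0.
    have h3 : (u - v) * (u + v) <= W ^+ 2 * d * (2 * W).
      apply: (@le_trans _ _ (W ^+ 2 * d * (u + v))).
        by rewrite ler_wpM2r//; lra.
      by rewrite ler_wpM2l//; lra.
    apply: (@le_trans _ _ (n * (W ^+ 2 * d * (2 * W)))).
      by rewrite ler_wpM2l.
    by rewrite ler_piMl// mulr_ge0//; lra.
  rewrite /L; lra.
exists L => // -[x Ux] [y Uy].
have x_ball : ball x0 e x by apply: interior_subset; exact: set_mem.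
have y_ball : ball x0 e y by apply: interior_subset; exact: set_mem.
have ilip z t : ball x0 e z -> ball x0 e t ->
    penalized_inf z - L * mdist z t <= penalized_inf t.
  move=> bz bt; apply: penalized_inf_ge => a; rewrite lerBlDr.
  exact: le_trans (penalized_inf_le z a) (plip _ _ _ bz bt).
have xy := ilip _ _ x_ball y_ball; have yx := ilip _ _ y_ball x_ball.
rewrite metric_sym in yx.
rewrite -[leLHS]/(`|penalized_inf y - penalized_inf x|).
rewrite -[leRHS]/(L * mdist x y) ler_norml; apply/andP; lra.
Qed.

End penalized_infimum.

End extension.

(* [R^o] is the library's carrier of the usual metric on [R]. *)
Theorem theorem4p1 (R : realType) (X : metricType R) (A : set X)
    (hA : closed A) (phi : A -> R^o) (hphi : locally_mlipschitz phi) :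
  exists Phi : X -> R^o,
    locally_mlipschitz Phi /\ (forall a : A, Phi (set_val a) = phi a).
Proof.
have [[x Ax]|A0] := pselect (A !=set0); last first.
  (* For empty [A] there is no [a0], and any constant extends [phi]. *)
  exists (fun=> 0); split=> [p|a]; last first.
    by case: A0; exists (set_val a); exact: set_valP.
  exists setT; split=> //; first exact: openT.
  by exists 0 => // u v; rewrite mul0r /sigL/= mdistxx.
pose a0 : A := SigSub (mem_set Ax).
have rho_gt0 := regularity_radius_gt0 hA hphi.
have rho_le1 := regularity_radius_le1 hA hphi.
have rho_lip := regularity_radius_lip hA hphi.
have rho_good := good_regularity_radius hA hphi.
exists (penalized_inf phi (regularity_radius phi)); split.
  exact: penalized_inf_locally_lip.
exact: penalized_inf_extends.
Qed.
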